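(* Let $n\ge1$ and $p>1$. Suppose $w:\mathbb{R}^n\to\mathbb{R}$ is a smooth solution of $$\Delta w-\tfrac12\,y\cdot\nabla w-\tfrac1{p-1}w+|w|^{p-1}w=0\quad\text{on }\mathbb{R}^n$$ satisfying $$\tfrac1{p-1}w(y)+\tfrac12\,y\cdot\nabla w(y)>0\quad\text{for all }y\in\mathbb{R}^n,$$ and suppose that one of the following conditions is satisfied: (1) $\displaystyle\int_{\mathbb{R}^n}|w|^{2p}e^{-\frac{|y|^2}{4}}\,dy<\infty$; (2) $p>1+\sqrt{\tfrac43}$. Then $w$ is constant, namely $w\equiv\kappa:=\left(\tfrac1{p-1}\right)^{\frac1{p-1}}$. *)

(* Defs.v *)
From HB Require Import structures.
From mathcomp Require Import all_boot all_order all_algebra.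
From mathcomp Require Import all_classical all_reals all_analysis.
Set Implicit Arguments.
Unset Strict Implicit.
Unset Printing Implicit Defensive.
Import Order.TTheory GRing.Theory Num.Theory.
Import numFieldNormedType.Exports.
Local Open Scope classical_set_scope.
Local Open Scope ring_scope.

Section calculus.
Context {R : realType} {n : nat}.
Implicit Types (f : 'rV[R]_n -> R) (x y : 'rV[R]_n).

Definition dotp x y : R := \sum_(i < n) x ord0 i * y ord0 i.

(* The norm [`|y|] of the library on ['rV[R]_n] is the sup norm; this is the
   squared Euclidean norm. *)
Definition sqnorm2 y : R := dotp y y.

Definition partial (i : 'I_n) f : 'rV[R]_n -> R :=
  fun y => 'D_(delta_mx ord0 i) f y.

Definition gradient f y : 'rV[R]_n := \row_(i < n) partial i f y.

Definition laplacian f y : R := \sum_(i < n) partial i (partial i f) y.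

(* [iter_partial [:: i1; ...; ik] f] is d_i1 ... d_ik f. *)
Definition iter_partial (s : seq 'I_n) f : 'rV[R]_n -> R :=
  foldr partial f s.

(* C^oo: the partial derivatives of all orders exist everywhere (the operator
   ['D_v] is total, so existence has to be required) and are continuous. *)
Definition smooth f : Prop :=
  forall s : seq 'I_n, continuous (iter_partial s f) /\
    forall (i : 'I_n) (y : 'rV[R]_n),
      derivable (iter_partial s f) y (delta_mx ord0 i).

End calculus.

Section cons_product_measure.
Context {d} {T : measurableType d} {R : realType} {n : nat}.

Definition tuple_cons (xt : T * n.-tuple T) : n.+1.-tuple T :=
  [tuple of xt.1 :: xt.2].

Definition tuple_uncons (t : n.+1.-tuple T) : T * n.-tuple T :=
  (tnth t ord0, [tuple of behead t]).

Lemma tuple_consK : cancel tuple_cons tuple_uncons.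
Proof. by move=> [x t]; congr pair; exact/val_inj. Qed.

Lemma measurable_tuple_cons : measurable_fun setT tuple_cons.
Proof. exact: measurable_cons. Qed.

HB.instance Definition _ :=
  isMeasurableFun.Build _ _ _ _ tuple_cons measurable_tuple_cons.

Lemma measurable_tuple_uncons : measurable_fun setT tuple_uncons.
Proof.
apply: measurable_fun_pair; first exact: measurable_tnth.
exact: measurable_behead.
Qed.

Variables (m1 : {sigma_finite_measure set T -> \bar R})
  (m2 : {sigma_finite_measure set (n.-tuple T) -> \bar R}).

Definition cons_product_measure : set (n.+1.-tuple T) -> \bar R :=
  pushforward (m1 \x m2)%E tuple_cons.

Let cons_product_measure0 : cons_product_measure set0 = 0%E.
Proof. exact: measure0. Qed.

Let cons_product_measure_ge0 A : (0 <= cons_product_measure A)%E.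
Proof. exact: measure_ge0. Qed.

Let cons_product_measure_sigma_additive :
  semi_sigma_additive cons_product_measure.
Proof. exact: measure_semi_sigma_additive. Qed.

HB.instance Definition _ := isMeasure.Build _ _ _ cons_product_measure
  cons_product_measure0 cons_product_measure_ge0
  cons_product_measure_sigma_additive.

Let cons_product_measure_sigma_finite : sigma_finite setT cons_product_measure.
Proof.
have /sigma_finiteP[F [TF ndF Foo]] := sigma_finiteT m1.
have /sigma_finiteP[G [TG ndG Goo]] := sigma_finiteT m2.
exists (fun k => tuple_uncons @^-1` (F k `*` G k)).
  rewrite -preimage_bigcup (_ : \bigcup_k _ = setT) ?preimage_setT//.
  apply/seteqP; split=> // -[x t] _.
  have [i _ Fx] : (\bigcup_k F k) x by rewrite -TF.
  have [j _ Gt] : (\bigcup_k G k) t by rewrite -TG.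
  exists (maxn i j) => //; split.
  - by move: x Fx; exact/subsetPset/ndF/leq_maxl.
  - by move: t Gt; exact/subsetPset/ndG/leq_maxr.
move=> k; have [mF Fk] := Foo k; have [mG Gk] := Goo k; split.
  rewrite -[X in measurable X]setTI; apply: measurable_tuple_uncons => //.
  exact: measurableX.
rewrite /cons_product_measure /pushforward -comp_preimage.
rewrite (_ : _ \o _ = id); last by apply/funext; exact: tuple_consK.
by rewrite product_measure1E// lte_mul_pinfty// ge0_fin_numE.
Qed.

HB.instance Definition _ := Measure_isSigmaFinite.Build _ _ _
  cons_product_measure cons_product_measure_sigma_finite.

End cons_product_measure.

Section lebesgue_measure_Rn.
Context {R : realType}.
Local Notation RT := (measurableTypeR R).

(* The n-fold product of the Lebesgue measure of R, the library's measurable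
   space R^n being [n.-tuple R]: the Dirac mass at the empty tuple for n = 0,
   and the image of the product measure on R * R^n under
   R * R^n ~ R^(n+1) in the inductive step. *)
Fixpoint lebesgue_tuple (n : nat) :
    {sigma_finite_measure set (n.-tuple RT) -> \bar R} :=
  match n with
  | 0 => dirac [tuple]
  | n'.+1 => cons_product_measure lebesgue_measure (lebesgue_tuple n')
  end.

Definition rV_of_tuple (n : nat) (t : n.-tuple RT) : 'rV[R]_n :=
  \row_(i < n) tnth t i.

Definition integral_Rn (n : nat) (f : 'rV[R]_n -> \bar R) : \bar R :=
  (\int[lebesgue_tuple n]_(t in [set: n.-tuple RT]) f (rV_of_tuple t))%E.

End lebesgue_measure_Rn.

Definition kappa {R : realType} (p : R) : R := (p - 1)^-1 `^ (p - 1)^-1.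

(* Main.v *)
Require Import Defs.
From HB Require Import structures.
From mathcomp Require Import all_boot all_order all_algebra.
From mathcomp Require Import all_classical all_reals all_analysis.
From mathcomp Require Import ring lra.
Import Order.TTheory GRing.Theory Num.Theory.
Import numFieldNormedType.Exports.
Local Open Scope classical_set_scope.
Local Open Scope ring_scope.

(** The proof is a chain of maximum principles for the Ornstein-Uhlenbeck
operator [L u = Delta u - y . grad u / 2].  Write [k = p - 1].  The quantity
[H = w / k + y . grad w / 2], assumed positive, generates the rescalings
[s^(1/k) w(sqrt s y)] of [w], so it is an eigenfunction of the equation linearized at
[w].  Once [w > 0] is known ([solution_gt0]), with [q = 1 / k - w ^ k],

     [L w = q w]     and     [L H = (k + 1) q H]     ([scaling_equation]).

For [a = ln w], [b = ln H] and [f = (1 + t) a - t b] this gives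
([combo_equation])

     [L f + |grad f|^2 = (1 - k t) q + t (1 + t) |grad (a - b)|^2].

At [t = 1 / k] the zeroth order term disappears and [exp f] is a subsolution of
[L].  The drift of [L] points to the origin, so a subsolution that grows at most
like [exp (|y|^2 / 32)] is constant ([ou_liouville]).  Then
[grad a = grad b] and [grad f = 0], hence [grad a = 0], [w] is constant, and the
equation gives its value.

It remains to prove that, for all [e > 0], [f <= e |y|^2 + C] with some [C].
- [b] is bounded below in this sense because [H] is a positive supersolution,
  [L H <= (p / k) H], and can be compared with small Gaussians
  ([subquadratic_opp_b]).
- At [t = 2 / k] the equation for [f] has the good sign
  [L f + |grad f|^2 >= w ^ k - 1 / k].  As [b] is bounded below, [w ^ k] dominates
  a power of [exp f], and the interior estimate of Keller and Osserman bounds [f]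
  by data on a unit ball ([subquadratic_combo]).
- That bound reads [H >= exp (- e |y|^2 - C) w ^ (1 + k / 2)].  Since [H]
  contains the radial derivative of [w], it is a superlinear differential
  inequality along rays, and a solution defined on the whole ray cannot be large
  ([subquadratic_a]). *)

(** * Derivatives along a direction *)

Section Directional.
Set Implicit Arguments.
Unset Strict Implicit.
Context {R : realType} {V : normedModType R}.
Implicit Types (f : V -> R) (x v : V).

(** Reduces directional derivatives to derivatives of functions of one real
variable, where the chain rule and the mean value theorem apply. *)
Lemma is_derive_line f x v d :
  is_derive x v f d <-> is_derive (0 : R) 1 (fun t : R => f (t *: v + x)) d.
Proof.
have E : (fun h : R => h^-1 *: ((f \o shift x) (h *: v) - f x)) =
  (fun h : R => h^-1 *: (((fun t : R => f (t *: v + x)) \o shift 0) (h *: (1 : R))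
    - (fun t : R => f (t *: v + x)) 0)).
  by apply/funext => h /=; rewrite addr0 scale0r add0r [_%:A]mulr1.
split=> -[fd fE]; split.
- exact: (derivable1P f x v).1.
- by rewrite -fE /derive E.
- exact: (derivable1P f x v).2.
- by rewrite -fE /derive E.
Qed.

Lemma is_derive_line_at f x v d (t : R) : is_derive (t *: v + x) v f d ->
  is_derive t 1 (fun s : R => f (s *: v + x)) d.
Proof.
move=> /is_derive_line H.
have -> : (fun s : R => f (s *: v + x)) =
  (fun s : R => f (s *: v + (t *: v + x))) \o (fun s => s - t).
  by apply/funext => s /=; rewrite addrA -scalerDl subrK.
rewrite -[d]mulr1; apply: is_derive1_comp; first by rewrite subrr.
have -> : (fun s : R => s - t) = id - cst t by [].
by apply: is_derive_eq; rewrite subr0.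
Qed.

Lemma is_derive_comp1 (g : R -> R) f x v dg df :
  is_derive (f x) 1 g dg -> is_derive x v f df ->
  is_derive x v (g \o f) (dg * df).
Proof.
move=> Hg /is_derive_line Hf; apply/is_derive_line.
by apply: (is_derive1_comp (f := g)) => //; rewrite scale0r add0r.
Qed.

End Directional.

Section Max1.
Set Implicit Arguments.
Unset Strict Implicit.
Context {R : realType}.

Lemma is_derive1_continuous (f : R -> R) (x d : R) :
  is_derive x (1 : R) f d -> {for x, continuous f}.
Proof. by move=> H; apply/differentiable_continuous/derivable1_diffP. Qed.

(** Were [l > 0], then [f'] would be positive just to the right of [0], and the
mean value theorem would make [f] exceed [f 0] there. *)
Lemma second_derivative_test (f f' : R -> R) (l : R) :
  (forall t : R, is_derive t (1 : R) f (f' t)) ->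
  is_derive (0 : R) (1 : R) f' l ->
  (\forall t \near (0 : R), f t <= f 0) -> f' 0 = 0 /\ l <= 0.
Proof.
move=> Hf Hl /nbhs_ballP[e /= e0 fmax].
have f'0 : f' 0 = 0.
  suff H : is_derive (0 : R) (1 : R) f 0 by case: (Hf 0) => _ <-; case: H.
  apply: (@derive1_at_max R f (- e) e 0).
  - by rewrite ge0_cp// ltW.
  - move=> t _; exact: ex_derive.
  - by rewrite in_itv/= oppr_lt0 e0.
  - move=> t; rewrite in_itv/= => te; apply: fmax.
    by rewrite /ball/= sub0r normrN ltr_norml.
split=> //; rewrite leNgt; apply/negP => l0.
have : \forall t \near 0^', 0 < t^-1 * f' t.
  have /cvgr_gt : (fun h : R =>
      h^-1 *: ((f' \o shift 0) (h *: (1 : R)) - f' 0)) @ 0^' --> l.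
    by case: Hl => d <-; exact: d.
  move=> /(_ _ l0); apply: filterS => h /=.
  by rewrite f'0 subr0 addr0 [_%:A]mulr1.
move=> /nbhs_ballP[d /= d0 Hd].
pose t := Num.min e d / 2.
have m0 : 0 < Num.min e d by rewrite lt_min e0 d0.
have t0 : 0 < t by rewrite divr_gt0.
have tm : t < Num.min e d by rewrite /t ltr_pdivrMr// ltr_pMr// ltr1n.
have [|c] := @MVT R f f' 0 t t0 (fun x _ => Hf x).
  by apply/continuous_subspaceT => x; exact: is_derive1_continuous.
rewrite in_itv/= => /andP[c0 ct].
have /fmax : ball 0 e t.
  by rewrite /ball/= sub0r normrN gtr0_norm// (lt_le_trans tm)// ge_min lexx.
move=> ft fE.
have : 0 < c^-1 * f' c.
  apply: Hd; last by rewrite gt_eqF.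
  rewrite /ball/= sub0r normrN gtr0_norm// (lt_trans ct)// (lt_le_trans tm)//.
  by rewrite ge_min lexx orbT.
rewrite pmulr_rgt0 ?invr_gt0// => f'c.
have : 0 < f t - f 0 by rewrite fE mulr_gt0// subr0.
by rewrite subr_gt0 ltNge ft.
Qed.
End Max1.

(** * Symmetry of mixed derivatives *)

Section Schwarz.
Set Implicit Arguments.
Unset Strict Implicit.
Context {R : realType} {V : normedModType R}.
Implicit Types (f : V -> R) (x u v : V).

(** The mean value theorem, once in the direction [u] and once in the direction
[v].  The left-hand side is symmetric in [u] and [v], which is what makes
[derive_comm] work. *)
Lemma second_difference f (fu fuv : V -> R) u v x (s : R) : 0 < s ->
  (forall y, is_derive y u f (fu y)) -> (forall y, is_derive y v fu (fuv y)) ->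
  exists z, `|z - x| <= s * (`|u| + `|v|) /\
    f (s *: u + (s *: v + x)) - f (s *: u + x) - (f (s *: v + x) - f x) =
    fuv z * s ^+ 2.
Proof.
move=> s0 Hu Huv.
pose G t := f (t *: u + (s *: v + x)) - f (t *: u + x).
pose G' t := fu (t *: u + (s *: v + x)) - fu (t *: u + x).
have HG (t : R) : is_derive t (1 : R) G (G' t).
  by apply: is_deriveB; exact: is_derive_line_at.
have [|a aI GE] := MVT s0 (fun t _ => HG t).
  by apply/continuous_subspaceT => t; exact: is_derive1_continuous.
pose K t := fu (t *: v + (a *: u + x)).
have HK (t : R) : is_derive t (1 : R) K (fuv (t *: v + (a *: u + x))).
  exact: is_derive_line_at.
have [|b bI KE] := MVT s0 (fun t _ => HK t).
  by apply/continuous_subspaceT => t; exact: is_derive1_continuous.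
move: aI bI; rewrite !in_itv/= => /andP[a0 a1] /andP[b0 b1].
exists (b *: v + (a *: u + x)); split.
  rewrite addrA addrK (le_trans (ler_normD _ _))// !normrZ !gtr0_norm//.
  by rewrite mulrDr addrC lerD// ler_wpM2r// ltW.
move: GE KE; rewrite /G /G' /K !scale0r !add0r !subr0 => ->.
by rewrite [s *: v + (a *: u + x)]addrCA => ->; rewrite expr2 mulrA.
Qed.

(** Both mixed derivatives are the limit of the second difference divided by
[s ^+ 2], as [s] tends to [0]. *)
Lemma derive_comm f (fu fv fuv fvu : V -> R) u v x :
  (forall y, is_derive y u f (fu y)) -> (forall y, is_derive y v f (fv y)) ->
  (forall y, is_derive y v fu (fuv y)) -> (forall y, is_derive y u fv (fvu y)) ->
  {for x, continuous fuv} -> {for x, continuous fvu} -> fuv x = fvu x.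
Proof.
move=> Hu Hv Huv Hvu cuv cvu; apply/eqP; rewrite -subr_eq0 -normr_le0.
apply/ler_addgt0Pr => e e0; rewrite add0r.
have e2 : 0 < e / 2 by rewrite divr_gt0.
have /cvgrPdist_le/(_ _ e2)/nbhs_ballP[d1 /= d10 H1] := cuv.
have /cvgrPdist_le/(_ _ e2)/nbhs_ballP[d2 /= d20 H2] := cvu.
pose N := `|u| + `|v| + 1.
have N0 : 0 < N by rewrite ltr_wpDl// addr_ge0.
pose s := Num.min d1 d2 / N.
have m0 : 0 < Num.min d1 d2 by rewrite lt_min d10 d20.
have s0 : 0 < s by rewrite divr_gt0.
have sN : s * (`|u| + `|v|) < Num.min d1 d2.
  by rewrite /s mulrAC ltr_pdivrMr// ltr_pM2l// /N ltrDl.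
have [z1 [z1x E1]] := second_difference x s0 Hu Huv.
have [z2 [z2x E2]] := second_difference x s0 Hv Hvu.
have zz : fuv z1 = fvu z2.
  have s2 : s ^+ 2 != 0 by rewrite expf_neq0// gt_eqF.
  apply: (mulIf s2); rewrite -E1 -E2 [s *: v + (s *: u + x)]addrCA; lra.
have B1 : ball x d1 z1.
  rewrite -ball_normE/= distrC (le_lt_trans z1x)// (lt_le_trans sN)//.
  by rewrite ge_min lexx.
have B2 : ball x d2 z2.
  rewrite -ball_normE/= distrC (le_lt_trans _ (lt_le_trans sN _))//.
    by rewrite [`|u| + _]addrC.
  by rewrite ge_min lexx orbT.
have := H1 _ B1; have := H2 _ B2 => /= h2 h1.
rewrite (_ : fuv x - fvu x = (fuv x - fuv z1) - (fvu x - fvu z2)).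
  by rewrite (le_trans (ler_normB _ _))// [e]splitr lerD.
by rewrite zz; lra.
Qed.

End Schwarz.

(** * Coordinate jets and interior maxima *)

Section MaximumPrinciple.
Set Implicit Arguments.
Unset Strict Implicit.
Context {R : realType} {n : nat}.
Local Notation rV := 'rV[R]_n.
Implicit Types (u v : rV -> R) (x y z : rV) (i j : 'I_n).

(** Gradient and diagonal of the Hessian, as explicit functions.  The operators
below involve no mixed second derivatives, so this much of the 2-jet suffices,
and it is computed by the usual rules from the jets of the constituents. *)
Definition jet2 u (g h : rV -> 'I_n -> R) := forall y i,
  is_derive y (delta_mx ord0 i) u (g y i) /\
  is_derive y (delta_mx ord0 i) (g^~ i) (h y i).

Lemma is_derive_coord y i j :
  is_derive y (delta_mx ord0 i) (fun z : rV => z ord0 j) ((i == j)%:R).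
Proof.
apply/is_derive_line.
have -> : (fun t : R => (t *: delta_mx ord0 i + y) ord0 j) =
          (i == j)%:R *: (id : R -> R) + cst (y ord0 j).
  by apply/funext => t; rewrite !mxE eqxx/= eq_sym mulrC.
by apply: is_derive_eq; rewrite addr0 [_ *: _]mulr1.
Qed.

Lemma jet2_cst c : jet2 (fun=> c) (fun _ _ => 0) (fun _ _ => 0).
Proof. by move=> y i; split; exact: is_derive_cst. Qed.

Lemma jet2D u v gu hu gv hv : jet2 u gu hu -> jet2 v gv hv ->
  jet2 (fun y => u y + v y) (fun y i => gu y i + gv y i)
    (fun y i => hu y i + hv y i).
Proof.
move=> Hu Hv y i; have [u1 u2] := Hu y i; have [v1 v2] := Hv y i.
by split; exact: is_deriveD.
Qed.

Lemma jet2Z c u gu hu : jet2 u gu hu ->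
  jet2 (fun y => c * u y) (fun y i => c * gu y i) (fun y i => c * hu y i).
Proof.
move=> Hu y i; have [u1 u2] := Hu y i.
by split; exact: is_deriveZ.
Qed.

Lemma jet2M u v gu hu gv hv : jet2 u gu hu -> jet2 v gv hv ->
  jet2 (fun y => u y * v y) (fun y i => gu y i * v y + u y * gv y i)
    (fun y i => hu y i * v y + 2 * gu y i * gv y i + u y * hv y i).
Proof.
move=> Hu Hv y i; have [u1 u2] := Hu y i; have [v1 v2] := Hv y i.
split; first by apply: is_derive_eq; rewrite /GRing.scale/=; lra.
apply: (is_derive_eq (is_deriveD (is_deriveM u2 v1) (is_deriveM u1 v2))).
by rewrite /GRing.scale/=; lra.
Qed.

Lemma jet2_sum (u_ : 'I_n -> rV -> R) (g_ h_ : 'I_n -> rV -> 'I_n -> R) :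
  (forall j, jet2 (u_ j) (g_ j) (h_ j)) ->
  jet2 (fun y => \sum_j u_ j y) (fun y i => \sum_j g_ j y i)
    (fun y i => \sum_j h_ j y i).
Proof.
move=> J y i; split.
  rewrite (_ : (fun y => _) = \sum_j u_ j).
    exact: (is_derive_sum (fun j => (J j y i).1)).
  by apply/funext => z; rewrite fct_sumE.
rewrite (_ : (fun y => _) = \sum_j (g_ j)^~ i).
  exact: (is_derive_sum (fun j => (J j y i).2)).
by apply/funext => z; rewrite fct_sumE.
Qed.

Lemma jet2_coord j : jet2 (fun y => y ord0 j) (fun _ i => (i == j)%:R)
  (fun _ _ => 0).
Proof.
by move=> y i; split; [exact: is_derive_coord|exact: is_derive_cst].
Qed.

Lemma jet2_expR u g h : jet2 u g h ->
  jet2 (fun y => expR (u y)) (fun y i => expR (u y) * g y i)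
    (fun y i => expR (u y) * (h y i + g y i ^+ 2)).
Proof.
move=> Hu y i; have [u1 u2] := Hu y i.
have E := is_derive_comp1 (is_derive_expR (u y)) u1.
split=> //; apply: (is_derive_eq (is_deriveM E u2)).
by rewrite /GRing.scale/= /comp; lra.
Qed.

Lemma jet2_ln u g h : (forall y, 0 < u y) -> jet2 u g h ->
  jet2 (fun y => ln (u y)) (fun y i => g y i / u y)
    (fun y i => h y i / u y - (g y i / u y) ^+ 2).
Proof.
move=> u0 Hu y i; have [u1 u2] := Hu y i; have uy0 := u0 y.
have un0 : u y != 0 by rewrite gt_eqF.
have E := is_derive_comp1 (is_derive1_ln uy0) u1.
split; first by apply: (is_derive_eq E); rewrite mulrC.
have HV := is_deriveV (f := id) un0 (is_derive_id _ (1 : R)).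
apply: (is_derive_eq (is_deriveM u2 (is_derive_comp1 HV u1))).
by rewrite /GRing.scale/=; field.
Qed.

Definition sqdist x y := sqnorm2 (y - x).

Lemma sqdistE x y : sqdist x y = \sum_i (y ord0 i - x ord0 i) ^+ 2.
Proof. by apply: eq_bigr => i _; rewrite !mxE expr2. Qed.

Lemma sqdist_ge0 x y : 0 <= sqdist x y.
Proof. by rewrite sqdistE sumr_ge0// => i _; exact: sqr_ge0. Qed.

Lemma sqdistxx x : sqdist x x = 0.
Proof. by rewrite sqdistE big1// => i _; rewrite subrr expr0n. Qed.

Lemma sqdist0 y : sqdist 0 y = sqnorm2 y.
Proof. by rewrite /sqdist subr0. Qed.

Lemma sqnorm2E y : sqnorm2 y = \sum_i y ord0 i ^+ 2.
Proof. by apply: eq_bigr => i _; rewrite expr2. Qed.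

Lemma sqnorm2_ge0 y : 0 <= sqnorm2 y.
Proof. by rewrite -sqdist0 sqdist_ge0. Qed.

Lemma sqnorm2_le x y : sqnorm2 y <= 2 * sqnorm2 x + 2 * sqdist x y.
Proof.
rewrite !sqnorm2E sqdistE !mulr_sumr -big_split/=; apply: ler_sum => i _.
by have := sqr_ge0 (y ord0 i - 2 * x ord0 i); lra.
Qed.

Lemma jet2_sqdist x : jet2 (sqdist x)
  (fun y i => 2 * (y ord0 i - x ord0 i)) (fun _ _ => 2).
Proof.
have H j := jet2D (jet2_coord j) (jet2_cst (- x ord0 j)).
have -> : sqdist x =
    fun y => \sum_j (y ord0 j + - x ord0 j) * (y ord0 j + - x ord0 j).
  by apply/funext => y; rewrite sqdistE; apply: eq_bigr => i _; rewrite expr2.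
have := jet2_sum (fun j => jet2M (H j) (H j)).
congr jet2; apply/funext => y; apply/funext => i.
  rewrite (bigD1 i)//= eqxx big1 ?addr0.
    by rewrite mul1r mulr1 mulr_natl mulr2n.
  by move=> j; rewrite eq_sym => /negbTE ->; rewrite addr0 mul0r mulr0 addr0.
rewrite (bigD1 i)//= eqxx big1 ?addr0; first by rewrite !(mul0r, mulr0, addr0, add0r, mulr1).
by move=> j; rewrite eq_sym => /negbTE ->; rewrite !(mul0r, mulr0, addr0).
Qed.

Lemma continuous_sqdist x : continuous (sqdist x).
Proof.
have -> : sqdist x = (fun y => \sum_(i < n) (y ord0 i - x ord0 i) ^+ 2).
  by apply/funext => y; rewrite sqdistE.
apply: continuous_big => [|i _ y]; first exact: add_continuous.
apply: (@continuous_comp _ _ _ (fun y : rV => y ord0 i - x ord0 i)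
  (fun t : R => t ^+ 2)).
  by apply: (continuousB (@coord_continuous R 1 n ord0 i y)); exact: cst_continuous.
exact: exprn_continuous.
Qed.

Lemma max_closed_ball u x (r : R) : continuous u -> 0 <= r ->
  exists2 y, sqdist x y <= r & forall z, sqdist x z <= r -> u z <= u y.
Proof.
move=> cu r0.
pose B := [set v : rV | forall i,
  `[x ord0 i - (r + 1), x ord0 i + (r + 1)]%classic (v ord0 i)].
have cB : compact B by exact: (rV_compact (fun i => @segment_compact R _ _)).
pose A := [set y | sqdist x y <= r].
have cA : compact A.
  apply: subclosed_compact cB _ .
    apply: (@closed_comp _ _ (sqdist x) [set t | t <= r]); last exact: closed_le.
    by move=> y _; exact: continuous_sqdist.
  move=> y; rewrite /A/= sqdistE => yr i /=; rewrite in_itv/=.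
  have : (y ord0 i - x ord0 i) ^+ 2 <= r.
    apply: le_trans yr; rewrite (bigD1 i)//= lerDl sumr_ge0// => j _.
    exact: sqr_ge0.
  by move=> H; apply/andP; split; nra.
have A0 : A !=set0 by exists x; rewrite /A/= sqdistxx.
have [y yA ymax] := EVT_max_rV A0 cA (continuous_subspaceT cu).
exists y; first by move: yA; rewrite inE.
by move=> z zr; apply: ymax; rewrite inE.
Qed.

(** All the comparison arguments below apply this lemma to a function built from a
cut-off or a barrier that depends on [sqdist x] only. *)
Lemma interior_max u g h x y0 (r : R) : continuous u -> jet2 u g h ->
  sqdist x y0 <= r -> (forall z, sqdist x z = r -> u z < u y0) ->
  exists y, [/\ sqdist x y < r, u y0 <= u y & forall i, g y i = 0 /\ h y i <= 0].
Proof.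
move=> cu Hu y0r bd.
have [y yr ymax] := max_closed_ball x cu (le_trans (sqdist_ge0 x y0) y0r).
have yltr : sqdist x y < r.
  rewrite lt_neqAle yr andbT; apply/eqP => /bd; rewrite ltNge.
  by rewrite ymax.
exists y; split=> [//||i]; first exact: ymax.
have := @second_derivative_test R (fun t => u (t *: delta_mx ord0 i + y))
  (fun t => g (t *: delta_mx ord0 i + y) i) (h y i).
rewrite scale0r add0r; apply.
- by move=> t; apply: is_derive_line_at; exact: (Hu _ i).1.
- exact: (is_derive_line (g^~ i) _ _ _).1 (Hu y i).2.
have : {for 0, continuous (fun t : R => sqdist x (t *: delta_mx ord0 i + y))}.
  apply: continuous_comp; last exact: continuous_sqdist.
  by apply: cvgD; [exact: scalel_continuous|exact: cvg_cst].
move=> /cvgr_lt /(_ r); rewrite scale0r add0r => /(_ yltr).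
by apply: filterS => t tr; apply: ymax; exact: ltW.
Qed.
End MaximumPrinciple.

(** * The Ornstein-Uhlenbeck operator and Gaussians *)

Section OrnsteinUhlenbeck.
Set Implicit Arguments.
Unset Strict Implicit.
Context {R : realType} {n : nat}.
Local Notation rV := 'rV[R]_n.
Implicit Types (u w : rV -> R) (x y z : rV) (i : 'I_n).

Lemma continuous_fctD u w : continuous u -> continuous w ->
  continuous (fun y => u y + w y).
Proof. by move=> cu cw y; exact: (continuousD (cu y) (cw y)). Qed.

Lemma continuous_fctM u w : continuous u -> continuous w ->
  continuous (fun y => u y * w y).
Proof. by move=> cu cw y; exact: (continuousM (cu y) (cw y)). Qed.

Lemma continuous_fctZ (c : R) u : continuous u -> continuous (fun y => c * u y).
Proof. by move=> cu; apply: continuous_fctM => // y; exact: cst_continuous. Qed.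

Lemma continuous_fct_expR u : continuous u -> continuous (fun y => expR (u y)).
Proof.
move=> cu y; apply: (@continuous_comp _ _ _ u expR); first exact: cu.
exact: continuous_expR.
Qed.

Lemma continuous_fct_ln u : (forall y, 0 < u y) -> continuous u ->
  continuous (fun y => ln (u y)).
Proof.
move=> u0 cu y; apply: (@continuous_comp _ _ _ u (@ln R)); first exact: cu.
exact/continuous_ln.
Qed.

Lemma sum_constE (c : R) : \sum_(i < n) c = n%:R * c.
Proof. by rewrite sumr_const card_ord mulr_natl. Qed.

(** On a ball where [u] takes a negative value, [(r - |y|^2) u] has a negative
interior minimum.  There [y . grad u = 2 |y|^2 u / (r - |y|^2)], so that
[c u + y . grad u / 2] is negative.  At a zero of a nonnegative [u] both terms
vanish. *)
Lemma pos_of_scaling u (g h : rV -> 'I_n -> R) (c : R) : 0 < c ->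
  continuous u -> jet2 u g h ->
  (forall y, 0 < c * u y + 2^-1 * \sum_i y ord0 i * g y i) ->
  forall y, 0 < u y.
Proof.
move=> c0 cu Hu Hpos.
have u_ge0 y0 : 0 <= u y0.
  rewrite leNgt; apply/negP => uy0.
  pose r := sqdist 0 y0 + 1.
  have J := jet2M (jet2D (jet2_sqdist 0) (jet2_cst (- r))) Hu.
  have cv : continuous (fun y => (sqdist 0 y + - r) * u y).
    apply: continuous_fctM => //; apply: continuous_fctD.
      exact: continuous_sqdist.
    by move=> y; exact: cst_continuous.
  have y0r : sqdist 0 y0 <= r by rewrite lerDl.
  have [z zr|y [yr]] := interior_max cv J y0r.
    by rewrite /= zr subrr mul0r /r; nra.
  rewrite /= (_ : sqdist 0 y0 - r = -1) ?mulN1r => [uy crit|]; last by rewrite /r; ring.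
  have uy_lt0 : u y < 0 by nra.
  have E : (r - sqdist 0 y) * (\sum_i y ord0 i * g y i) = 2 * sqdist 0 y * u y.
    rewrite mulr_sumr [in RHS]sqdistE mulr_sumr mulr_suml; apply: eq_bigr => i _.
    have [+ _] := crit i; rewrite !mxE subr0 addr0 => ci.
    have {}ci : (sqdist 0 y - r) * g y i = - (2 * y ord0 i * u y) by lra.
    rewrite (_ : _ * _ = - y ord0 i * ((sqdist 0 y - r) * g y i)); last by ring.
    by rewrite ci; ring.
  have := Hpos y; set S := \sum_i _ in E *.
  have := sqdist_ge0 0 y; nra.
(* Subtracting [sqdist x] makes the maximum of [- u] at its zero [x] strict. *)
move=> x; rewrite lt_neqAle u_ge0 andbT; apply/eqP => ux.
have J := jet2D (jet2Z (-1) Hu) (jet2Z (-1) (jet2_sqdist x)).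
have cv : continuous (fun y => -1 * u y + -1 * sqdist x y).
  apply: continuous_fctD; apply: continuous_fctZ => //.
  exact: continuous_sqdist.
have xx : sqdist x x <= 1 by rewrite sqdistxx.
have [z zr|y [_]] := interior_max cv J xx.
  by rewrite /= sqdistxx -ux zr; have := u_ge0 z; lra.
rewrite /= sqdistxx -ux => uy crit.
have := u_ge0 y; have := sqdist_ge0 x y => y1 y2.
have [y0 uy0] : sqdist x y = 0 /\ u y = 0 by split; lra.
have := Hpos y; rewrite uy0 big1 => [|i _]; first by lra.
have [] := crit i; move: y0; rewrite sqdistE.
move=> /eqP; rewrite psumr_eq0 => [/allP/(_ i)|j _]; last exact: sqr_ge0.
rewrite mem_index_enum sqrf_eq0 => /(_ isT)/eqP -> H _.
by rewrite (_ : g y i = 0) ?mulr0//; lra.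
Qed.

Lemma nbhs_sqdist x (P : rV -> Prop) : (\forall z \near x, P z) ->
  exists2 d : R, 0 < d & forall z, sqdist x z < d -> P z.
Proof.
move=> /nbhs_ballP[e /= e0 H]; exists (e ^+ 2); first by rewrite exprn_gt0.
move=> z zd; apply: H; split=> // i j; rewrite ord1 /ball/= ltr_norml.
have : (z ord0 j - x ord0 j) ^+ 2 < e ^+ 2.
  apply: le_lt_trans zd; rewrite sqdistE (bigD1 j)//= lerDl sumr_ge0// => l _.
  exact: sqr_ge0.
by move=> H2; apply/andP; split; nra.
Qed.

Definition gaussian_grad (c : R) x y i : R :=
  expR (c * sqdist x y) * (c * (2 * (y ord0 i - x ord0 i))).
Definition gaussian_hess (c : R) x y i : R :=
  expR (c * sqdist x y) * (c * 2 + (c * (2 * (y ord0 i - x ord0 i))) ^+ 2).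

Lemma jet2_gaussian (c : R) x : jet2 (fun y => expR (c * sqdist x y))
  (gaussian_grad c x) (gaussian_hess c x).
Proof. exact: (jet2_expR (jet2Z c (jet2_sqdist x))). Qed.

Lemma continuous_gaussian (c : R) x : continuous (fun y => expR (c * sqdist x y)).
Proof.
by apply: continuous_fct_expR; apply: continuous_fctZ; exact: continuous_sqdist.
Qed.

Lemma ou_gaussian (c : R) x y :
  \sum_i (gaussian_hess c x y i - 2^-1 * y ord0 i * gaussian_grad c x y i) =
  c * expR (c * sqdist x y) * ((4 * c - 1) * sqdist x y + 2 * n%:R
    - \sum_i x ord0 i * (y ord0 i - x ord0 i)).
Proof.
rewrite [2 * n%:R]mulrC -sum_constE [in X in _ * X]sqdistE mulr_sumr.
rewrite -big_split/= -sumrB mulr_sumr; apply: eq_bigr => i _.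
by rewrite /gaussian_hess /gaussian_grad; field.
Qed.

Lemma cross_term_bound x y :
  `|\sum_i x ord0 i * (y ord0 i - x ord0 i)| <= sqdist x y / 4 + sqnorm2 x.
Proof.
have -> : sqdist x y / 4 + sqnorm2 x =
    \sum_i ((y ord0 i - x ord0 i) ^+ 2 / 4 + x ord0 i ^+ 2).
  by rewrite sqdistE sqnorm2E mulr_suml -big_split.
rewrite (le_trans (ler_norm_sum _ _ _))//; apply: ler_sum => i _.
rewrite ler_norml; set s := y ord0 i - _; set t := x ord0 i.
have := sqr_ge0 (s / 2 + t); have := sqr_ge0 (s / 2 - t).
by move=> *; apply/andP; split; lra.
Qed.

(** A radial supersolution away from [x] that still tends to infinity like
[expR (sqdist x y / 8)]: the growing Gaussian is a strict supersolution far from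
[x], and subtracting a large multiple of a sharply peaked one corrects it nearby. *)
Lemma ou_barrier x (d : R) : 0 < d -> exists K A : R, [/\ 0 < K, 0 <= A &
  forall y, d <= sqdist x y ->
  \sum_i (gaussian_hess 8^-1 x y i - 2^-1 * y ord0 i * gaussian_grad 8^-1 x y i)
  - A * \sum_i (gaussian_hess (- K) x y i
      - 2^-1 * y ord0 i * gaussian_grad (- K) x y i) < 0].
Proof.
move=> d0; pose N := 2 * n%:R + sqnorm2 x + 1.
have N0 : 0 < N by rewrite ltr_wpDl// addr_ge0 ?sqnorm2_ge0// mulr_ge0.
(* [K] makes the peaked Gaussian a subsolution as soon as [d <= sqdist x y], and
   [A] makes it dominate on the region [sqdist x y < 4 * N], outside of which
   the other Gaussian has the right sign. *)
pose K := (N + 1) / (3 * d).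
have K0 : 0 < K by apply: divr_gt0; [exact: addr_gt0|exact: mulr_gt0].
pose A := expR (N / 2) * N * expR (4 * K * N) / K.
have A0 : 0 <= A.
  by apply: divr_ge0; rewrite ?(ltW K0)// !mulr_ge0 ?expR_ge0 ?(ltW N0).
exists K, A; split=> // y dy; rewrite !ou_gaussian.
have := cross_term_bound x y; rewrite ler_norml.
set X := \sum_i _; set rho := sqdist x y in dy * => /andP[X1 X2].
have Kd : N + 1 = 3 * K * d by rewrite /K; field; lra.
have KeA : 0 <= K * expR (- K * rho) * A.
  by apply: mulr_ge0 => //; apply: mulr_ge0; [exact: ltW|exact: expR_ge0].
have E2 : K * expR (- K * rho) * A <=
    A * (- K * expR (- K * rho) * ((4 * - K - 1) * rho + 2 * n%:R - X)) .
  rewrite (_ : A * (- K * expR (- K * rho) * ((4 * - K - 1) * rho + 2 * n%:R - X)) =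
    K * expR (- K * rho) * A * ((4 * K + 1) * rho - 2 * n%:R + X)); last by ring.
  rewrite ler_peMr//.
  have Kr : K * d <= K * rho by rewrite ler_pM2l.
  have rho0 : 0 <= rho := sqdist_ge0 x y.
  have Kr0 : 0 <= K * rho by rewrite mulr_ge0// ltW.
  by move: Kd; rewrite /N; lra.
have E1 : 8^-1 * expR (8^-1 * rho) * ((4 * 8^-1 - 1) * rho + 2 * n%:R - X) <=
    8^-1 * expR (8^-1 * rho) * (N - rho / 4 - 1).
  by rewrite ler_pM2l ?mulr_gt0 ?expR_gt0// /N; lra.
rewrite subr_lt0.
have e8 := expR_gt0 (8^-1 * rho); have eK := expR_gt0 (- K * rho).
have [rN|rN] := leP (4 * N) rho.
  have : 8^-1 * expR (8^-1 * rho) * (N - rho / 4 - 1) < 0.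
    by rewrite pmulr_rlt0 ?mulr_gt0//; lra.
  by move=> H; exact: le_lt_trans E1 (lt_le_trans H (le_trans KeA E2)).
have F1 : expR (8^-1 * rho) <= expR (N / 2) by rewrite ler_expR; lra.
have F2 : expR (N / 2) * N <= K * expR (- K * rho) * A.
  rewrite (_ : K * expR (- K * rho) * A =
    expR (N / 2) * N * expR (4 * K * N - K * rho)); last first.
    rewrite mulNr expRN expRB /A; field.
    by rewrite !gt_eqF ?expR_gt0.
  rewrite ler_peMr ?mulr_ge0 ?expR_ge0 ?(ltW N0)// -[leLHS]expR0 ler_expR.
  have : K * rho <= K * (4 * N) by rewrite ler_pM2l// ltW.
  by lra.
have F3 : 8^-1 * expR (8^-1 * rho) * (N - rho / 4 - 1) <= 8^-1 * (expR (N / 2) * N).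
  rewrite -mulrA ler_pM2l// (le_trans (ler_wpM2l (ltW e8) (_ : _ <= N)))//.
    by have := sqdist_ge0 x y; rewrite -/rho; lra.
  by rewrite ler_pM2r.
have : 0 < expR (N / 2) * N by rewrite mulr_gt0 ?expR_gt0.
move=> Q0; apply: le_lt_trans (le_trans E1 F3) (lt_le_trans _ (le_trans F2 E2)).
by lra.
Qed.

End OrnsteinUhlenbeck.

(** * A Liouville theorem *)

Section Liouville.
Set Implicit Arguments.
Unset Strict Implicit.
Context {R : realType} {n : nat}.
Local Notation rV := 'rV[R]_n.

(** Subtract a small multiple of the barrier centred at [x].  The growth bound
forces an interior maximum, the sign of the operator forces it to lie near [x],
where [u] is close to [u x].  The pole [x] of the barrier is arbitrary, and this
is what yields a constant and not only an attained maximum. *)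
Lemma ou_liouville (u : rV -> R) (g h : rV -> 'I_n -> R) (C : R) :
  continuous u -> jet2 u g h ->
  (forall y, 0 <= \sum_i (h y i - 2^-1 * y ord0 i * g y i)) ->
  (forall y, u y <= expR (32^-1 * sqnorm2 y + C)) ->
  forall x y, u y <= u x.
Proof.
move=> cu Hu sub growth x y1; rewrite leNgt; apply/negP => xy1.
pose mu := (u x + u y1) / 2.
have xmu : u x < mu by rewrite /mu; lra.
have muy1 : mu < u y1 by rewrite /mu; lra.
clearbody mu.
have [d d0 near_x] : exists2 d : R, 0 < d & forall z, sqdist x z < d -> u z < mu.
  by apply: nbhs_sqdist; have /cvgr_lt := cu x; exact.
have [K [A [K0 A0 barrier]]] := ou_barrier x d0.
set rho1 := sqdist x y1.
pose M := expR (8^-1 * rho1) + A.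
have M0 : 0 < M by rewrite ltr_pwDl ?expR_gt0.
pose eta := (u y1 - mu) / M / 2.
have eta0 : 0 < eta by rewrite !divr_gt0// subr_gt0.
have etaM : eta * M < u y1 - mu.
  have -> : eta * M = (u y1 - mu) / 2 by rewrite /eta; field; rewrite gt_eqF.
  by lra.
clearbody eta.
pose E z := u z + (- eta * expR (8^-1 * sqdist x z)
  + eta * A * expR (- K * sqdist x z)).
have JE := jet2D Hu (jet2D (jet2Z (- eta) (jet2_gaussian 8^-1 x))
  (jet2Z (eta * A) (jet2_gaussian (- K) x))).
have cE : continuous E.
  apply: continuous_fctD => //; apply: continuous_fctD; apply: continuous_fctZ;
  exact: continuous_gaussian.
have K1 z : 0 <= eta * A * expR (- K * sqdist x z) <= eta * A.
  apply/andP; split; first by rewrite !mulr_ge0 ?expR_ge0// ltW.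
  rewrite ler_piMr ?mulr_ge0 ?(ltW eta0)// expR_le1 mulNr oppr_le0.
  by rewrite mulr_ge0 ?sqdist_ge0// ltW.
have Ey1 : mu + eta * A < E y1.
  have := K1 y1; rewrite /E -/rho1 => /andP[? _].
  by move: etaM; rewrite /M mulrDr; lra.
(* On the sphere [sqdist x z = r] the growth bound is [D * X] with
   [X = expR (r / 16)], while the barrier contributes [- eta * X ^+ 2]. *)
pose D := expR (16^-1 * sqnorm2 x + C).
have D0 : 0 < D by exact: expR_gt0.
pose T := (D + `|mu|) / eta.
have T0 : 0 <= T by rewrite divr_ge0 ?addr_ge0 ?(ltW D0)// ltW.
pose r := 16 * T + rho1.
have rho10 : 0 <= rho1 := sqdist_ge0 x y1.
have y1r : sqdist x y1 <= r by rewrite /r -/rho1; lra.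
have [z zr|y [_]] := interior_max cE JE y1r.
  apply: le_lt_trans Ey1; rewrite /E zr.
  have := K1 z; rewrite zr => /andP[_].
  suff : u z - eta * expR (8^-1 * r) <= mu by lra.
  have X0 := expR_ge1Dx (16^-1 * r); set X := expR _ in X0.
  have -> : expR (8^-1 * r) = X * X by rewrite -expRD; congr expR; lra.
  have : u z <= D * X.
    rewrite (le_trans (growth z))// -expRD ler_expR.
    by have := sqnorm2_le x z; rewrite zr; lra.
  have XT : 1 + T <= X by move: X0; rewrite /r; lra.
  have : eta * T = D + `|mu| by rewrite /T; field; rewrite gt_eqF.
  have := ler_norm (- mu); rewrite normrN.
  have : eta * T <= eta * X by rewrite ler_pM2l//; lra.
  move: (`|mu|) (normr_ge0 mu) => m m0 e1 e2 e3 e4.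
  have : (D + m) * X <= eta * X * X by rewrite ler_wpM2r//; lra.
  have : m * 1 <= m * X by rewrite ler_wpM2l//; lra.
  by lra.
move=> Emax crit.
have dy : d <= sqdist x y.
  rewrite leNgt; apply/negP => /near_x uy.
  have : E y < mu + eta * A.
    have := K1 y; rewrite /E => /andP[_ ?].
    by have := mulr_gt0 eta0 (expR_gt0 (8^-1 * sqdist x y)); lra.
  by rewrite ltNge => /negP; apply; rewrite (le_trans _ Emax)// ltW.
have := barrier y dy; set S1 := (X in X - _); set S2 := (X in _ - A * X) => S12.
have : \sum_i (h y i - 2^-1 * y ord0 i * g y i) - eta * (S1 - A * S2) <= 0.
  rewrite /S1 /S2 mulr_sumr -sumrB mulr_sumr -sumrB.
  apply: sumr_le0 => i _; have [c1 c2] := crit i.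
  by move: c1 c2; move: (2^-1 * _) => q c1 c2; nra.
by have := sub y; nra.
Qed.

End Liouville.

(** * The system satisfied by the logarithms *)

Section LogEquations.
Set Implicit Arguments.
Unset Strict Implicit.
Context {R : realType} {n : nat}.
Local Notation rV := 'rV[R]_n.
Context (k : R) (a b : rV -> R) (ga ha gb hb : rV -> 'I_n -> R).

(** Growth from above smaller than any multiple of the squared norm, which is the
scale on which Gaussians can be used as barriers. *)
Definition subquadratic (u : rV -> R) := forall e : R, 0 < e ->
  exists C, forall y, u y <= e * sqnorm2 y + C.

(** Common potential of the two equations: [L w = q w] for the solution, and
[L H = (k + 1) q H] for the generator of its rescalings. *)
Let q y := k^-1 - expR (k * a y).

(** The equations of a positive solution [expR a] and of the generator [expR b]
of its rescalings, in logarithmic form; [ga], [ha], [gb], [hb] are their jets. *)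
Record log_system : Prop := LogSystem {
  exponent_gt0 : 0 < k;
  continuous_a : continuous a;
  continuous_b : continuous b;
  jet_a : jet2 a ga ha;
  jet_b : jet2 b gb hb;
  equation_a : forall y,
    \sum_i (ha y i - 2^-1 * y ord0 i * ga y i + ga y i ^+ 2) = q y;
  equation_b : forall y,
    \sum_i (hb y i - 2^-1 * y ord0 i * gb y i + gb y i ^+ 2) = (k + 1) * q y;
  equation_ab : forall y,
    expR (b y) = expR (a y) * (k^-1 + 2^-1 * \sum_i y ord0 i * ga y i)
}.

Context (S : log_system).
Let k0 := exponent_gt0 S.

Lemma affine_le_expR (A B e : R) : 0 <= A -> 0 <= B -> 0 < e ->
  exists C, forall s, 0 <= s -> A + B * s <= expR (e * s + C).
Proof.
move=> A0 B0 e0; exists (A + B / e) => s s0.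
have D0 : 0 <= A + B / e by rewrite addr_ge0// divr_ge0// ltW.
rewrite expRD; have := expR_ge1Dx (e * s); have := expR_ge1Dx (A + B / e).
set z := expR (A + B / e); set x := expR (e * s) => z1 x1.
have es0 : 0 <= e * s by rewrite mulr_ge0// ltW.
have : (A + B / e) * (1 + e * s) <= z * x.
  apply: ler_pM => //; lra.
have -> : (A + B / e) * (1 + e * s) = A + B / e + A * (e * s) + B * s.
  by field; rewrite gt_eqF.
have := mulr_ge0 A0 es0; have : 0 <= B / e by rewrite divr_ge0// ltW.
by lra.
Qed.

(** [expR b] satisfies [L H <= (k + 1) / k * H], and far from the origin
[expR (- e |y|^2)] is a strict subsolution of the same linear equation that tends
to [0] at infinity; a small multiple of it stays below [H]. *)
Lemma subquadratic_opp_b : subquadratic (fun y => - b y).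
Proof.
move=> e e0.
(* Beyond the radius [r0] the Gaussian is a strict subsolution. *)
pose r0 := (k^-1 * (k + 1) + 1 + 2 * n%:R * e) / e.
have ki : 0 < k^-1 by rewrite invr_gt0.
have r00 : 0 <= r0.
  rewrite divr_ge0 ?(ltW e0)// !addr_ge0 ?mulr_ge0 ?(ltW e0) ?(ltW ki)//.
  by rewrite addr_ge0// ltW.
have cb : continuous (fun y => expR (b y)).
  exact/continuous_fct_expR/(continuous_b S).
have cNb : continuous (fun y => -1 * expR (b y)) by exact: continuous_fctZ.
have [ym _ ymin] := max_closed_ball 0 cNb r00.
pose c := expR (b ym).
have c0 : 0 < c by exact: expR_gt0.
suff H y : c * expR (- e * sqdist 0 y) <= expR (b y).
  exists (- b ym) => y /=; have := H y; rewrite /c -expRD ler_expR sqdist0; lra.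
rewrite leNgt; apply/negP => yc.
pose d := c * expR (- e * sqdist 0 y) - expR (b y).
have d0 : 0 < d by rewrite subr_gt0.
have J := jet2D (jet2Z c (jet2_gaussian (- e) 0)) (jet2Z (-1) (jet2_expR (jet_b S))).
have cu : continuous (fun y => c * expR (- e * sqdist 0 y) + -1 * expR (b y)).
  apply: continuous_fctD => //; apply: continuous_fctZ.
  exact: continuous_gaussian.
pose r := sqdist 0 y + c / (e * d).
have ed : 0 < e * d by rewrite mulr_gt0.
have yr : sqdist 0 y <= r by rewrite lerDl divr_ge0// ltW.
have [z zr|z [_ zy crit]] := interior_max cu J yr.
  rewrite zr mulN1r [ltRHS](_ : _ = d); last by rewrite mulN1r.
  suff : c * expR (- e * r) <= d by have := expR_gt0 (b z); lra.
  rewrite mulNr expRN ler_pdivrMr ?expR_gt0//.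
  have er : c / d <= e * r.
    rewrite /r mulrDr [e * (c / _)](_ : _ = c / d); last first.
      by field; rewrite !gt_eqF.
    by rewrite lerDr mulr_ge0 ?sqdist_ge0// ltW.
  rewrite mulrC -ler_pdivrMr//; apply: le_trans er _.
  by have := expR_ge1Dx (e * r); lra.
have {}zy : d <= c * expR (- e * sqdist 0 z) - expR (b z).
  by rewrite /d; move: zy; lra.
have e1 : expR (- e * sqdist 0 z) <= 1.
  by rewrite expR_le1 mulNr oppr_le0 mulr_ge0 ?sqdist_ge0// ltW.
have zr0 : r0 < sqdist 0 z.
  rewrite ltNge; apply/negP => /ymin; rewrite -/c.
  have : c * expR (- e * sqdist 0 z) <= c * 1 by rewrite ler_pM2l.
  by lra.
have : c * \sum_i (gaussian_hess (- e) 0 z i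
        - 2^-1 * z ord0 i * gaussian_grad (- e) 0 z i)
   - expR (b z) * ((k + 1) * q z) <= 0.
  rewrite -equation_b// !mulr_sumr -sumrB; apply: sumr_le0 => i _.
  have [c1 c2] := crit i; move: c1 c2; move: (2^-1 * _) => t c1 c2.
  move/eqP: c1; rewrite addr_eq0 mulN1r opprK => /eqP c1.
  by have := congr1 ( *%R t) c1; lra.
rewrite ou_gaussian (_ : \sum_i (0 : rV) ord0 i * _ = 0); last first.
  by rewrite big1// => i _; rewrite mxE mul0r.
have rb : k^-1 * (k + 1) + 1 <= e * sqdist 0 z - 2 * n%:R * e.
  have : e * r0 <= e * sqdist 0 z by rewrite ler_pM2l// ltW.
  rewrite {1}/r0 [e * _](_ : _ = k^-1 * (k + 1) + 1 + 2 * n%:R * e).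
    by lra.
  by field; rewrite !gt_eqF.
set E := expR (- e * _) in zy e1 *; set B := expR (b z) in zy *.
have qk : B * ((k + 1) * q z) <= B * (k^-1 * (k + 1)).
  rewrite [k^-1 * _]mulrC ler_pM2l ?expR_gt0// ler_pM2l ?addr_gt0//.
  by rewrite /q gerBl expR_ge0.
have E0 : 0 < c * E by rewrite mulr_gt0// expR_gt0.
have F1 : c * E * (k^-1 * (k + 1) + 1) <=
  c * (- e * E * ((4 * - e - 1) * sqdist 0 z + 2 * n%:R - 0)).
  rewrite (_ : c * (- e * E * _) =
   c * E * (e * sqdist 0 z - 2 * n%:R * e + 4 * e * (e * sqdist 0 z))); last by ring.
  rewrite ler_pM2l//; have : 0 <= 4 * e * (e * sqdist 0 z); last by lra.
  by rewrite !mulr_ge0 ?sqdist_ge0// ltW.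
have F2 : B * (k^-1 * (k + 1)) <= c * E * (k^-1 * (k + 1)).
  by rewrite ler_pM2r ?mulr_gt0 ?addr_gt0//; lra.
by lra.
Qed.

Definition combo (t : R) y := (1 + t) * a y + - t * b y.
Definition combo_grad (t : R) y i := (1 + t) * ga y i + - t * gb y i.
Definition combo_hess (t : R) y i := (1 + t) * ha y i + - t * hb y i.

Lemma jet2_combo t : jet2 (combo t) (combo_grad t) (combo_hess t).
Proof. exact: jet2D (jet2Z _ (jet_a S)) (jet2Z _ (jet_b S)). Qed.

Lemma continuous_combo t : continuous (combo t).
Proof.
apply: continuous_fctD; apply: continuous_fctZ.
  exact: (continuous_a S).
exact: (continuous_b S).
Qed.

(** The cross terms complete to a square since the coefficients of [a] and [b]
add up to [1]. *)
Lemma combo_equation t y :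
  \sum_i (combo_hess t y i - 2^-1 * y ord0 i * combo_grad t y i
          + combo_grad t y i ^+ 2) =
  (1 - k * t) * q y + t * (1 + t) * \sum_i (ga y i - gb y i) ^+ 2.
Proof.
have -> : (1 - k * t) * q y = (1 + t) * q y - t * ((k + 1) * q y) by ring.
rewrite -{1}(equation_a S) -(equation_b S) !mulr_sumr -sumrB -big_split/=.
by apply: eq_bigr => i _; rewrite /combo_grad /combo_hess; ring.
Qed.

(** The interior estimate of Keller and Osserman.  For [f = combo (2 / k)], the
function [(1 - sqdist x y) * expR (s * f y)] has a maximum in the unit ball about
[x].  There [grad f] is explicit and [L f] is bounded by the cut-off, so the
equation bounds [expR (k * a)]; the lower bound on [b] turns this into a bound on
[expR (s * f)], which at the centre has cut-off [1]. *)
Lemma subquadratic_combo : subquadratic (combo (2 / k)).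
Proof.
set t := 2 / k.
have t0 : 0 < t by rewrite divr_gt0.
have kt : k * t = 2 by rewrite /t; field; rewrite gt_eqF.
(* Chosen such that [2 * s * f = k * a - 2 * s * t * b], see [st]. *)
pose s := k ^+ 2 / (2 * (k + 2)).
have s0 : 0 < s by rewrite divr_gt0 ?exprn_gt0 ?mulr_gt0 ?addr_gt0.
have st : 2 * s * (1 + t) = k.
  by rewrite /s /t; field; rewrite gt_eqF//= gt_eqF// addr_gt0.
have ki : 0 < k^-1 by rewrite invr_gt0.
clearbody s t.
pose B := s^-1; have B0 : 0 < B by rewrite invr_gt0.
pose A := k^-1 + (2 * n%:R + 4 + 4 / s) / s.
have A0 : 0 <= A.
  apply: addr_ge0; first exact: ltW.
  by apply: divr_ge0; rewrite ?(ltW s0)// !addr_ge0 ?mulr_ge0// ltW.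
move=> e e0.
have [C1 HC1] := affine_le_expR A0 (ltW B0) (mulr_gt0 s0 e0).
have e'0 : 0 < e / (4 * t) by rewrite divr_gt0 ?mulr_gt0.
have [C0 HC0] := subquadratic_opp_b e'0.
exists ((C1 + 2 * s * t * (2 * (e / (4 * t)) + C0)) / (2 * s)) => x.
set e' := e / (4 * t) in e'0 HC0 *.
have e'E : 2 * s * t * (2 * e') = s * e.
  by rewrite /e'; field; rewrite gt_eqF.
have J := jet2M (jet2D (jet2_cst 1) (jet2Z (-1) (jet2_sqdist x)))
  (jet2_expR (jet2Z s (jet2_combo t))).
have cu : continuous (fun y => (1 + -1 * sqdist x y) * expR (s * combo t y)).
  apply: continuous_fctM.
    apply: continuous_fctD; first by move=> y; exact: cst_continuous.
    by apply: continuous_fctZ; exact: continuous_sqdist.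
  by apply: continuous_fct_expR; apply: continuous_fctZ; exact: continuous_combo.
have xx : sqdist x x <= 1 by rewrite sqdistxx.
have [z zr|y [yx uxy crit]] := interior_max cu J xx.
  by rewrite zr sqdistxx mulr1 subrr mul0r mulr0 addr0 mul1r expR_gt0.
move: uxy; rewrite sqdistxx mulr0 addr0 mul1r.
set th := 1 + -1 * sqdist x y; set E := expR (s * combo t y) => uxy.
have rho0 := sqdist_ge0 x y.
have th0 : 0 < th by rewrite /th; lra.
have th1 : th <= 1 by rewrite /th; lra.
have E0 : 0 < E by exact: expR_gt0.
have key i : combo_hess t y i - 2^-1 * y ord0 i * combo_grad t y i
          + combo_grad t y i ^+ 2 <=
   (2 + x ord0 i ^+ 2 + (4 + 4 / s) * (y ord0 i - x ord0 i) ^+ 2) / (s * th ^+ 2).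
  have [] := crit i; rewrite -/th -/E.
  set z := y ord0 i - x ord0 i.
  set G := combo_grad t y i; set H := combo_hess t y i => c1 c2.
  have GE : G = 2 * z / (s * th).
    have : E * (th * (s * G) - 2 * z) = 0 by move: c1; lra.
    move=> /eqP; rewrite mulf_eq0 gt_eqF//= subr_eq0 => /eqP c.
    apply: (mulfI (_ : s * th != 0)); first by rewrite gt_eqF// mulr_gt0.
    by rewrite mulrC; move: c => c; field: c; rewrite !gt_eqF.
  have HE : H * (s * th ^+ 2) <= 2 * th + 4 * z ^+ 2.
    have : E * (- 2 - 4 * z * (s * G) + th * (s * H + (s * G) ^+ 2)) <= 0.
      by move: c2; lra.
    rewrite pmulr_rle0// GE => c.
    rewrite -subr_le0; set W := (X in X <= 0) in c.
    have <- : th * W = H * (s * th ^+ 2) - (2 * th + 4 * z ^+ 2).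
      by rewrite /W; field; rewrite !gt_eqF.
    by rewrite pmulr_rle0.
  rewrite ler_pdivlMr ?mulr_gt0 ?exprn_gt0// GE.
  rewrite [leLHS](_ : _ = H * (s * th ^+ 2) - y ord0 i * z * th + 4 / s * z ^+ 2);
    last by field; rewrite !gt_eqF.
  have -> : y ord0 i = z + x ord0 i by rewrite /z subrK.
  have : - ((z + x ord0 i) * z * th) <= x ord0 i ^+ 2.
    have : 0 <= th * (z + x ord0 i / 2) ^+ 2 by rewrite mulr_ge0 ?sqr_ge0// ltW.
    have : 0 <= (1 - th) * x ord0 i ^+ 2 by rewrite mulr_ge0 ?sqr_ge0// subr_ge0.
    by have := sqr_ge0 (x ord0 i); lra.
  by lra.
(* The equation at [t = 2 / k], multiplied by the square of the cut-off. *)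
have tha : th ^+ 2 * expR (k * a y) <= A + B * sqnorm2 x.
  have : expR (k * a y) - k^-1 <= (2 * n%:R + sqnorm2 x + (4 + 4 / s)) / (s * th ^+ 2).
    have : - q y <= \sum_i (combo_hess t y i - 2^-1 * y ord0 i * combo_grad t y i
          + combo_grad t y i ^+ 2).
      rewrite combo_equation kt (_ : 1 - 2 = -1) ?mulN1r; last by ring.
      rewrite lerDl !mulr_ge0 ?addr_ge0 ?(ltW t0)//.
      by apply: sumr_ge0 => i _; exact: sqr_ge0.
    rewrite /q opprB => /le_trans; apply.
    apply: le_trans (ler_sum _ (fun i _ => key i)) _.
    rewrite -mulr_suml ler_pM2r ?invr_gt0 ?mulr_gt0 ?exprn_gt0//.
    rewrite !big_split/= -mulr_sumr -sqdistE -sqnorm2E sum_constE.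
    have : (4 + 4 / s) * sqdist x y <= (4 + 4 / s) * 1.
      rewrite ler_wpM2l//; first by rewrite addr_ge0// divr_ge0// ltW.
      by move: th0; rewrite /th; lra.
    by lra.
  rewrite ler_pdivlMr ?mulr_gt0 ?exprn_gt0// => c.
  have th2 : th ^+ 2 <= 1 by rewrite expr_le1// ltW.
  have := ler_wpM2l (ltW ki) th2; rewrite mulr1.
  have : (th ^+ 2 * expR (k * a y) - k^-1 * th ^+ 2) * s <=
      2 * n%:R + sqnorm2 x + (4 + 4 / s).
    by move: c; lra.
  rewrite -ler_pdivlMr// => c3.
  rewrite /A /B; move: c3; rewrite !mulrDl; lra.
have ux2 : expR (2 * s * combo t x) <= th ^+ 2 * expR (2 * s * combo t y).
  have sqE z : expR (2 * s * combo t z) = expR (s * combo t z) ^+ 2.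
    by rewrite -expRM_natl mulrA.
  by rewrite !sqE -/E -exprMn ler_pXn2r// ?nnegrE ?expR_ge0// mulr_ge0// ltW.
have : expR (2 * s * combo t x) <= expR (s * e * sqnorm2 x + C1
   + 2 * s * t * (e' * (2 * sqnorm2 x + 2) + C0)).
  apply: le_trans ux2 _.
  have -> : 2 * s * combo t y = k * a y + 2 * s * t * - b y.
    by rewrite -st /combo; ring.
  rewrite expRD mulrA [leRHS]expRD; apply: ler_pM; rewrite ?expR_ge0//.
  - by rewrite mulr_ge0 ?expR_ge0// exprn_ge0// ltW.
  - exact: le_trans tha (HC1 _ (sqnorm2_ge0 x)).
  rewrite ler_expR ler_wpM2l ?mulr_ge0 ?(ltW s0) ?(ltW t0)//.
  apply: le_trans (HC0 y) _; rewrite lerD2r ler_wpM2l ?(ltW e'0)//.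
  by have := sqnorm2_le x y; lra.
rewrite ler_expR => c.
have s20 : 0 < 2 * s by rewrite mulr_gt0.
rewrite -(ler_pM2l s20); apply: le_trans c _.
rewrite [leRHS](_ : _ = 2 * s * (e * sqnorm2 x)
  + (C1 + 2 * s * t * (2 * e' + C0))); last by field; rewrite gt_eqF.
have := congr1 ( *%R (sqnorm2 x)) e'E.
by lra.
Qed.

(** At an interior maximum of [(r - |y|^2) * expR (k / 2 * a y)] the radial
derivative of [a] is explicit, and with it the quotient [expR (b - a)].  But
[k / 2 * combo (2 / k) = k / 2 * a + a - b], so the previous estimate bounds
[expR (k / 2 * a)] itself. *)
Lemma subquadratic_a : subquadratic a.
Proof.
move=> e e0; have e20 : 0 < e / 2 by rewrite divr_gt0.
have [C HC] := subquadratic_combo e20.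
pose c := k / 2; have c0 : 0 < c by rewrite divr_gt0.
have ki : 0 < k^-1 by rewrite invr_gt0.
pose A := k^-1 + c^-1; have A0 : 0 <= A by apply: addr_ge0; rewrite ?invr_ge0 ltW.
have [C1 HC1] := affine_le_expR A0 A0 (mulr_gt0 c0 e20).
exists (e / 2 + C + C1 / c) => z.
pose r := sqdist 0 z + 1.
have J := jet2M (jet2D (jet2_cst r) (jet2Z (-1) (jet2_sqdist 0)))
  (jet2_expR (jet2Z c (jet_a S))).
have cu : continuous (fun y => (r + -1 * sqdist 0 y) * expR (c * a y)).
  apply: continuous_fctM.
    apply: continuous_fctD; first by move=> y; exact: cst_continuous.
    by apply: continuous_fctZ; exact: continuous_sqdist.
  by apply: continuous_fct_expR; apply: continuous_fctZ; exact: (continuous_a S).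
have zr : sqdist 0 z <= r by rewrite lerDl.
have [x xr|y [yr uzy crit]] := interior_max cu J zr.
  rewrite xr mulN1r subrr mul0r mulr_gt0 ?expR_gt0//.
  by rewrite /r; lra.
move: uzy; rewrite (_ : r + -1 * sqdist 0 z = 1) ?mul1r; last by rewrite /r; ring.
set th := r + -1 * sqdist 0 y => uzy.
have th0 : 0 < th by rewrite /th; lra.
have rho0 := sqdist_ge0 0 y.
have gE : \sum_i y ord0 i * ga y i = 2 * sqdist 0 y / (c * th).
  rewrite sqdistE mulr_sumr mulr_suml; apply: eq_bigr => i _.
  have [+ _] := crit i; rewrite -/th mxE subr0.
  set E := expR _; have E0 : 0 < E by exact: expR_gt0.
  move=> c1; have : E * (th * (c * ga y i) - 2 * y ord0 i) = 0 by move: c1; lra.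
  move=> /eqP; rewrite mulf_eq0 gt_eqF//= subr_eq0 => /eqP c2.
  have -> : ga y i = 2 * y ord0 i / (c * th).
    apply: (mulfI (_ : c * th != 0)); first by rewrite gt_eqF// mulr_gt0.
    rewrite [RHS]mulrC divfK ?gt_eqF ?mulr_gt0// -c2; ring.
  by field; rewrite !gt_eqF.
have bE : expR (b y) = expR (a y) * (k^-1 + sqdist 0 y / (c * th)).
  by rewrite (equation_ab S) gE; congr (_ * (_ + _)); field; rewrite !gt_eqF.
have fE : expR (c * a y) * th =
    expR (c * combo (2 / k) y) * (k^-1 * th + sqdist 0 y / c).
  have -> : c * combo (2 / k) y = c * a y + a y - b y.
    by rewrite /combo /c; field; rewrite gt_eqF.
  set W := k^-1 + _ in bE.
  have W0 : W != 0.
    by have := expR_gt0 (b y); rewrite bE; apply: contraTneq => ->; rewrite mulr0 ltxx.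
  have -> : k^-1 * th + sqdist 0 y / c = th * W.
    by rewrite /W; field; rewrite !gt_eqF.
  rewrite expRD expRN expRD bE; field.
  by rewrite W0 gt_eqF ?expR_gt0.
have y2r : sqnorm2 y <= r by rewrite -sqdist0; move: th0; rewrite /th; lra.
have le1 : expR (c * a z) <=
    expR (c * (e / 2 * r + C)) * expR (c * (e / 2) * sqnorm2 z + C1).
  apply: le_trans uzy _; rewrite mulrC fE; apply: ler_pM.
  - exact: expR_ge0.
  - by rewrite addr_ge0 ?mulr_ge0 ?invr_ge0 ?(ltW th0) ?(ltW k0) ?(ltW c0).
  - rewrite ler_expR ler_pM2l//; apply: le_trans (HC y) _.
    by rewrite lerD2r ler_pM2l.
  apply: le_trans (HC1 _ (sqnorm2_ge0 z)).
  have -> : A + A * sqnorm2 z = k^-1 * r + r / c.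
    by rewrite /A /r sqdist0; ring.
  rewrite lerD// ?ler_pM2l ?ler_pM2r ?invr_gt0//; first by rewrite /th; lra.
  by rewrite sqdist0.
move: le1; rewrite -expRD ler_expR /r sqdist0 => le1.
rewrite /= -(ler_pM2l c0).
have -> : c * (e * sqnorm2 z + (e / 2 + C + C1 / c)) =
  c * (e / 2 * (sqnorm2 z + 1) + C) + (c * (e / 2) * sqnorm2 z + C1).
  by field; rewrite gt_eqF.
by [].
Qed.

Lemma jet2_const_eq0 (u : rV -> R) (g h : rV -> 'I_n -> R) (c : R) :
  jet2 u g h -> (forall y, u y = c) -> forall y i, g y i = 0 /\ h y i = 0.
Proof.
move=> J uc.
have g0 y i : g y i = 0.
  have [+ _] := J y i; rewrite (_ : u = cst c) => [[_ <-]|]; last exact/funext.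
  exact: derive_cst.
move=> y i; split; first exact: g0.
have [_] := J y i; rewrite (_ : g^~ i = cst 0) => [[_ <-]|].
  exact: derive_cst.
by apply/funext => z; rewrite /= g0.
Qed.

Lemma log_system_constant y : expR (k * a y) = k^-1.
Proof.
set t := k^-1.
have t0 : 0 < t by rewrite invr_gt0.
have kt : k * t = 1 by rewrite mulfV// gt_eqF.
have fsum z := combo_equation t z.
have e1 : 0 < 32^-1 / (2 * (1 + t)) :> R by rewrite divr_gt0 ?mulr_gt0 ?addr_gt0.
have e2 : 0 < 32^-1 / (2 * t) :> R by rewrite divr_gt0 ?mulr_gt0.
have [C1 HC1] := subquadratic_a e1; have [C2 HC2] := subquadratic_opp_b e2.
have J := jet2_expR (jet2_combo t).
have cE : continuous (fun y => expR (combo t y)).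
  by apply: continuous_fct_expR; exact: continuous_combo.
have const x z : expR (combo t z) <= expR (combo t x).
  apply: (ou_liouville (C := (1 + t) * C1 + t * C2) cE J) => {x z} z.
    have : 0 <= expR (combo t z) * \sum_i (combo_hess t z i
        - 2^-1 * z ord0 i * combo_grad t z i + combo_grad t z i ^+ 2).
      rewrite fsum kt subrr mul0r add0r !mulr_ge0 ?expR_ge0 ?addr_ge0 ?(ltW t0)//.
      by apply: sumr_ge0 => i _; exact: sqr_ge0.
    rewrite mulr_sumr => /le_trans; apply.
    by apply: ler_sum => i _; lra.
  rewrite ler_expR /combo.
  have := ler_wpM2l (ltW t0) (HC2 z).
  have t1 : 0 <= 1 + t by rewrite addr_ge0// ltW.
  have := ler_wpM2l t1 (HC1 z).
  have -> : (1 + t) * (32^-1 / (2 * (1 + t)) * sqnorm2 z + C1) =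
    64^-1 * sqnorm2 z + (1 + t) * C1 by field; lra.
  have -> : t * (32^-1 / (2 * t) * sqnorm2 z + C2) =
    64^-1 * sqnorm2 z + t * C2 by field; rewrite gt_eqF.
  by lra.
(* [combo t] is constant, and at [t = k^-1] what remains of its equation is the
   square of [ga - gb]. *)
have combo_cst z : combo t z = combo t 0.
  by apply/eqP; rewrite eq_le -!(ler_expR (combo t _)) !const.
have f0 := jet2_const_eq0 (jet2_combo t) combo_cst.
have ga0 z i : ga z i = 0.
  have := fsum z; rewrite kt subrr mul0r add0r big1 => [|j _]; last first.
    by have [-> ->] := f0 z j; rewrite mulr0 subrr expr0n addr0.
  move=> /esym/eqP; rewrite mulf_eq0 [_ * _ == 0]gt_eqF ?mulr_gt0 ?addr_gt0//=.
  rewrite psumr_eq0 => [/allP/(_ i)|j _]; last exact: sqr_ge0.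
  rewrite mem_index_enum sqrf_eq0 subr_eq0 => /(_ isT)/eqP gab.
  have [+ _] := f0 z i; rewrite /combo_grad -gab; lra.
have ha0 z i : ha z i = 0.
  have [_] := jet_a S z i; rewrite (_ : ga^~ i = cst 0) => [[_ <-]|].
    exact: derive_cst.
  by apply/funext => y0; rewrite /= ga0.
have := equation_a S y; rewrite big1 => [|i _]; last first.
  by rewrite ga0 ha0 mulr0 subrr expr0n addr0.
by rewrite /q -/t => /eqP; rewrite eq_sym subr_eq0 => /eqP.
Qed.
End LogEquations.

(** * The generator of rescalings *)

Section ScalingGenerator.
Set Implicit Arguments.
Unset Strict Implicit.
Context {R : realType} {n : nat}.
Local Notation rV := 'rV[R]_n.
Context {w : rV -> R}.
Context (w_smooth : smooth w).

Lemma is_derive_iter_partial s y (i : 'I_n) :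
  is_derive y (delta_mx ord0 i) (iter_partial s w) (iter_partial (i :: s) w y).
Proof. by apply: derivableP; exact: (w_smooth s).2. Qed.

Lemma partial_comm s (i j : 'I_n) :
  iter_partial [:: i, j & s] w = iter_partial [:: j, i & s] w.
Proof.
apply/funext => y.
exact: (derive_comm (is_derive_iter_partial s ^~ j) (is_derive_iter_partial s ^~ i)
  (is_derive_iter_partial (j :: s) ^~ i) (is_derive_iter_partial (i :: s) ^~ j)
  ((w_smooth _).1 y) ((w_smooth _).1 y)).
Qed.

Lemma partial_comm_sqr (i j : 'I_n) :
  iter_partial [:: j; j; i] w = iter_partial [:: i; j; j] w.
Proof.
transitivity (iter_partial [:: j; i; j] w).
  exact: (congr1 (partial j) (partial_comm [::] j i)).
exact: (partial_comm [:: j] j i).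
Qed.

Lemma jet2_iter_partial s : jet2 (iter_partial s w)
  (fun y i => iter_partial (i :: s) w y)
  (fun y i => iter_partial [:: i, i & s] w y).
Proof.
move=> y i; split; first exact: (is_derive_iter_partial s).
exact: (is_derive_iter_partial (i :: s)).
Qed.

Lemma sum_delta (F : 'I_n -> R) i : \sum_j (i == j)%:R * F j = F i.
Proof.
rewrite (bigD1 i)//= eqxx mul1r big1 ?addr0// => j /negbTE.
by rewrite eq_sym => ->; rewrite mul0r.
Qed.

(** Derivative at [s = 1] of the rescaling [y |-> s `^ c * w (s `^ 2^-1 *: y)], for
[c = k^-1] the scaling that leaves [Delta w + |w| `^ k * w = 0] invariant. *)
Definition scaling_generator (c : R) y :=
  c * w y + 2^-1 * \sum_j y ord0 j * iter_partial [:: j] w y.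

Definition scaling_grad (c : R) y i :=
  c * iter_partial [:: i] w y + 2^-1 * (iter_partial [:: i] w y
    + \sum_j y ord0 j * iter_partial [:: i; j] w y).

Definition scaling_hess (c : R) y i :=
  c * iter_partial [:: i; i] w y + 2^-1 * (2 * iter_partial [:: i; i] w y
    + \sum_j y ord0 j * iter_partial [:: i; i; j] w y).

(** The derivative of a coordinate contributes one extra term per derivative of
[w], whence the terms free of the position [y]. *)
Lemma jet2_radial : jet2 (fun y => \sum_j y ord0 j * iter_partial [:: j] w y)
  (fun y i => iter_partial [:: i] w y
    + \sum_j y ord0 j * iter_partial [:: i; j] w y)
  (fun y i => 2 * iter_partial [:: i; i] w y
    + \sum_j y ord0 j * iter_partial [:: i; i; j] w y).
Proof.
have J := jet2_sum (fun j => jet2M (jet2_coord j) (jet2_iter_partial [:: j])).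
move=> y i; have [J1 J2] := J y i; split.
  by apply: (is_derive_eq J1); rewrite big_split/= sum_delta.
move: J2; rewrite (_ : (fun y => \sum_(i0 < n) _) = fun y => iter_partial [:: i] w y
    + \sum_j y ord0 j * iter_partial [:: i; j] w y); last first.
  by apply/funext => z; rewrite big_split/= sum_delta.
move=> J2; apply: (is_derive_eq J2); rewrite !big_split/=.
rewrite big1 ?add0r => [|j _]; last by rewrite mul0r.
congr (_ + _); under eq_bigr do rewrite -mulrA.
by rewrite -mulr_sumr sum_delta.
Qed.

Lemma jet2_scaling c :
  jet2 (scaling_generator c) (scaling_grad c) (scaling_hess c).
Proof. exact: jet2D (jet2Z c (jet2_iter_partial [::])) (jet2Z 2^-1 jet2_radial). Qed.

Lemma continuous_scaling c : continuous (scaling_generator c).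
Proof.
apply: continuous_fctD; apply: continuous_fctZ; first exact: (w_smooth [::]).1.
apply: continuous_big => [|j _]; first exact: add_continuous.
apply: continuous_fctM; last exact: (w_smooth [:: j]).1.
exact: (@coord_continuous R 1 n ord0 j).
Qed.

Context {k : R}.
Context (k0 : 0 < k).
Context (w_eq : forall y,
  laplacian w y - 2^-1 * dotp y (gradient w y) - k^-1 * w y
    + `|w y| `^ k * w y = 0).
Context (H_pos : forall y, 0 < k^-1 * w y + 2^-1 * dotp y (gradient w y)).

Lemma dotp_gradientE y :
  dotp y (gradient w y) = \sum_j y ord0 j * iter_partial [:: j] w y.
Proof. by apply: eq_bigr => j _; rewrite mxE. Qed.

Lemma solution_gt0 y : 0 < w y.
Proof.
apply: (pos_of_scaling (c := k^-1) _ (w_smooth [::]).1 (jet2_iter_partial [::])).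
  by rewrite invr_gt0.
by move=> z; rewrite -dotp_gradientE.
Qed.

Let q y := k^-1 - expR (k * ln (w y)).

Lemma equationE y :
  \sum_j iter_partial [:: j; j] w y
   - 2^-1 * (\sum_j y ord0 j * iter_partial [:: j] w y) = q y * w y.
Proof.
have := w_eq y; rewrite dotp_gradientE gtr0_norm ?solution_gt0//.
rewrite /powR gt_eqF ?solution_gt0// -[laplacian w y]/(\sum_j iter_partial [:: j; j] w y).
rewrite /q => E.
by apply/eqP; rewrite -subr_eq0 -[eqbRHS]E; apply/eqP; ring.
Qed.

(** The partial derivative of the equation; [expR (k * ln w)] is [w `^ k]. *)
Lemma equation_derived y i :
  \sum_j iter_partial [:: i; j; j] w y
   - 2^-1 * (iter_partial [:: i] w y + \sum_j y ord0 j * iter_partial [:: i; j] w y)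
  = (k^-1 - (k + 1) * expR (k * ln (w y))) * iter_partial [:: i] w y.
Proof.
pose F z := (\sum_j iter_partial [:: j; j] w z
   + - 2^-1 * (\sum_j z ord0 j * iter_partial [:: j] w z))
   + (- k^-1 * w z + expR (k * ln (w z)) * w z).
have F0 : F = fun=> 0.
  apply/funext => z; have := equationE z; rewrite /F /q => E.
  have -> : \sum_j iter_partial [:: j; j] w z =
    2^-1 * (\sum_j z ord0 j * iter_partial [:: j] w z) +
    (k^-1 - expR (k * ln (w z))) * w z by rewrite -E; ring.
  by ring.
have Jw := jet2_iter_partial [::].
have JF := jet2D (jet2D (jet2_sum (fun j => jet2_iter_partial [:: j; j]))
   (jet2Z (- 2^-1) jet2_radial))
  (jet2D (jet2Z (- k^-1) Jw) (jet2M (jet2_expR (jet2Z k (jet2_ln solution_gt0 Jw))) Jw)).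
have [] := jet2_const_eq0 (c := 0) JF _ y i.
  by move=> z; rewrite -[RHS]/((fun=> 0) z) -F0.
move=> + _; rewrite /= => E.
have wn : w y != 0 by rewrite gt_eqF ?solution_gt0.
apply/eqP; rewrite -subr_eq0 -[eqbRHS]E; apply/eqP; field.
by rewrite wn gt_eqF.
Qed.

(** Contracting the differentiated equation with [y] evaluates [L (y . grad w)], up
to commuting derivatives; the Laplacian that is left over is eliminated by the
equation itself. *)
Lemma scaling_equation y :
  \sum_i (scaling_hess k^-1 y i - 2^-1 * y ord0 i * scaling_grad k^-1 y i) =
  (k + 1) * q y * scaling_generator k^-1 y.
Proof.
set Y := \sum_j y ord0 j * iter_partial [:: j] w y.
set L := \sum_j iter_partial [:: j; j] w y.
pose T := \sum_i y ord0 i * (\sum_j iter_partial [:: i; j; j] w y).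
pose Q := \sum_i y ord0 i * (\sum_j y ord0 j * iter_partial [:: i; j] w y).
have TE : \sum_i \sum_j y ord0 j * iter_partial [:: i; i; j] w y = T.
  rewrite exchange_big; apply: eq_bigr => i _; rewrite mulr_sumr.
  by apply: eq_bigr => j _; rewrite partial_comm_sqr.
have sumE : \sum_i (scaling_hess k^-1 y i - 2^-1 * y ord0 i * scaling_grad k^-1 y i) =
   k^-1 * L + 2^-1 * (2 * L + T) - 2^-1 * (k^-1 * Y + 2^-1 * (Y + Q)).
  rewrite sumrB; congr (_ - _).
    by rewrite big_split/= -!mulr_sumr big_split/= -mulr_sumr TE.
  transitivity (\sum_i 2^-1 * (k^-1 * (y ord0 i * iter_partial [:: i] w y)
      + 2^-1 * (y ord0 i * iter_partial [:: i] w y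
        + y ord0 i * \sum_j y ord0 j * iter_partial [:: i; j] w y))); last first.
    by rewrite -mulr_sumr big_split/= -!mulr_sumr big_split.
  by apply: eq_bigr => i _; rewrite /scaling_grad; ring.
have derE : T - 2^-1 * (Y + Q) = (k^-1 - (k + 1) * expR (k * ln (w y))) * Y.
  transitivity (\sum_i y ord0 i * (\sum_j iter_partial [:: i; j; j] w y
      - 2^-1 * (iter_partial [:: i] w y
        + \sum_j y ord0 j * iter_partial [:: i; j] w y))).
    rewrite -[Y + Q]big_split/= [2^-1 * _]mulr_sumr -sumrB.
    by apply: eq_bigr => i _; ring.
  rewrite [RHS]mulr_sumr; apply: eq_bigr => i _.
  by rewrite equation_derived; ring.
have LE : L = 2^-1 * Y + q y * w y by rewrite -equationE; rewrite -/L -/Y; ring.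
have {}derE : T = 2^-1 * (Y + Q) + (k^-1 - (k + 1) * expR (k * ln (w y))) * Y.
  by rewrite -derE; ring.
rewrite sumE /scaling_generator -/Y derE LE /q; field.
by rewrite gt_eqF.
Qed.

Lemma scaling_generator_gt0 y : 0 < scaling_generator k^-1 y.
Proof. by rewrite /scaling_generator -dotp_gradientE. Qed.

Lemma log_system_of_solution : exists ga ha gb hb,
  log_system k (fun y => ln (w y)) (fun y => ln (scaling_generator k^-1 y))
    ga ha gb hb.
Proof.
have Jw : jet2 w (fun y i => iter_partial [:: i] w y)
  (fun y i => iter_partial [:: i; i] w y) := jet2_iter_partial [::].
have wn y : w y != 0 by rewrite gt_eqF ?solution_gt0.
have Hn y : scaling_generator k^-1 y != 0 by rewrite gt_eqF ?scaling_generator_gt0.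
do 4 eexists; split.
- exact: k0.
- by apply: continuous_fct_ln; [exact: solution_gt0|exact: (w_smooth [::]).1].
- by apply: continuous_fct_ln; [exact: scaling_generator_gt0|exact: continuous_scaling].
- exact: (jet2_ln solution_gt0 Jw).
- exact: (jet2_ln scaling_generator_gt0 (jet2_scaling k^-1)).
- move=> y /=; apply: (mulIf (wn y)); rewrite -[RHS]equationE mulr_sumr mulr_suml -sumrB.
  by apply: eq_bigr => i _ /=; field.
- move=> y /=; apply: (mulIf (Hn y)); rewrite -[RHS]scaling_equation mulr_suml.
  by apply: eq_bigr => i _ /=; field.
- move=> y; rewrite !lnK ?posrE ?solution_gt0 ?scaling_generator_gt0// /scaling_generator.
  rewrite (_ : \sum_j _ =
    w y * \sum_i y ord0 i * (iter_partial [:: i] w y / w y)); first by ring.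
  by rewrite mulr_sumr; apply: eq_bigr => i _ /=; field.
Qed.
End ScalingGenerator.

Theorem theorem1p2 (R : realType) (n : nat) (hn : (1 <= n)%N)
  (p : R) (hp : 1 < p) (w : 'rV[R]_n -> R) (w_smooth : smooth w)
  (w_eq : forall y : 'rV[R]_n,
     laplacian w y - 2^-1 * dotp y (gradient w y) - (p - 1)^-1 * w y
       + `|w y| `^ (p - 1) * w y = 0)
  (w_pos : forall y : 'rV[R]_n,
     0 < (p - 1)^-1 * w y + 2^-1 * dotp y (gradient w y))
  (h12 : (integral_Rn (fun y : 'rV[R]_n =>
            (`|w y| `^ (2 * p) * expR (- (sqnorm2 y / 4)))%:E) < +oo)%E
         \/ 1 + Num.sqrt (4 / 3) < p) :
  forall y : 'rV[R]_n, w y = kappa p.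
Proof.
move=> y; have k0 : 0 < p - 1 by rewrite subr_gt0.
have [ga [ha [gb [hb S]]]] := log_system_of_solution w_smooth k0 w_eq w_pos.
have w0 := solution_gt0 w_smooth k0 w_pos y.
have E := log_system_constant S y.
rewrite /kappa -[X in X `^ _]E /powR gt_eqF ?expR_gt0// expRK mulrA mulVf ?gt_eqF//.
by rewrite mul1r lnK.
Qed.
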